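(* Let $O_A, O_B, O_C$ be three circles in the Euclidean plane with centers $A, B, C$ respectively, pairwise externally tangent, with $O_B, O_C$ tangent at $X$, $O_A, O_C$ tangent at $Y$, and $O_A, O_B$ tangent at $Z$. Suppose that the following is given: the circles $O_A, O_B, O_C$ and the lines $AB$ and $AC$ are already drawn, and the points $A, B, C, X, Y, Z$ are known. Then, starting from this configuration, a circle tangent to each of $O_A$, $O_B$ and $O_C$ is constructible by straightedge and compass in at most seven moves (the drawing of the tangent circle itself being counted as a move).
   Context: Two circles are tangent if they meet in exactly one point; they are externally tangent if moreover the distance between their centers is the sum of their radii. All circles have positive radius. Straightedge-and-compass constructions and the counting of moves. A configuration consists of a finite set of known points and a finite set of drawn objects (lines and circles) in the Euclidean plane. A move is the drawing of either (i) the full infinite line through two distinct known points, or (ii) the circle centered at a known point and passing through another known point. Points are free: at no cost one may add to the known points any point of intersection of two distinct drawn objects, and one may also choose an arbitrary point, in the plane or on a drawn object. An arbitrary choice may not be used to pick out a specific unconstructed point: the construction must succeed for every choice of the point in some nonempty open subset of the plane, respectively some nonempty relatively open subset of the drawn object. Formally, ''a circle with property $P$ is constructible from a configuration in at most $n$ moves'' is defined inductively as follows. It holds if some drawn circle has property $P$. It also holds if one of the following is true: (a) $n\ge 1$ and after performing some move (i) or (ii), such a circle is constructible from the resulting configuration in at most $n-1$ moves; (b) after adding to the known points some intersection point of two distinct drawn objects, such a circle is constructible from the resulting configuration in at most $n$ moves; (c) there is a nonempty open subset $U$ of the plane, or a nonempty relatively open subset $U$ of a drawn object, such that for every $p\in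 U$, after adding $p$ to the known points, such a circle is constructible from the resulting configuration in at most $n$ moves. The sequence of steps may depend on the given configuration (for instance, on whether certain lines are parallel). *)

(* Defs.v *)
(* Stdlib reals; the topology on [R * R] is Coquelicot's. *)
From Stdlib Require Import Reals List.
From Coquelicot Require Import Coquelicot.
Open Scope R_scope.

Definition point : Type := (R * R)%type.

Definition dist_pt (p q : point) : R := dist_euc (fst p) (snd p) (fst q) (snd q).

(* The line of equation [a * x + b * y = c]. Proportional coefficients give the
   same line, so lines are only ever compared through their points. *)
Record line : Type := Line {
  line_a : R;
  line_b : R;
  line_c : R;
  line_nondeg : line_a <> 0 \/ line_b <> 0
}.

Record circle : Type := Circle {
  center : point;
  radius : R;
  radius_pos : 0 < radius
}.

Definition on_line (l : line) (p : point) : Prop :=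
  line_a l * fst p + line_b l * snd p = line_c l.

Definition on_circle (c : circle) (p : point) : Prop :=
  dist_pt (center c) p = radius c.

Definition tangent_at (c1 c2 : circle) (p : point) : Prop :=
  unique (fun q => on_circle c1 q /\ on_circle c2 q) p.

Definition tangent (c1 c2 : circle) : Prop :=
  exists p, tangent_at c1 c2 p.

Definition externally_tangent_at (c1 c2 : circle) (p : point) : Prop :=
  tangent_at c1 c2 p /\
  dist_pt (center c1) (center c2) = radius c1 + radius c2.

Inductive object : Type :=
| ObjLine (l : line)
| ObjCircle (c : circle).

Definition on (o : object) (p : point) : Prop :=
  match o with
  | ObjLine l => on_line l p
  | ObjCircle c => on_circle c p
  end.

Definition distinct_objects (o1 o2 : object) : Prop :=
  ~ (forall p, on o1 p <-> on o2 p).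

(* [constructible P n pts objs]: a circle with property [P] is constructible in
   at most [n] moves from known points [pts] and drawn objects [objs]. *)
Inductive constructible (P : circle -> Prop) :
    nat -> list point -> list object -> Prop :=
| constructible_drawn n pts objs c :
    In (ObjCircle c) objs -> P c ->
    constructible P n pts objs
| constructible_line n pts objs l p q :
    In p pts -> In q pts -> p <> q ->
    on_line l p -> on_line l q ->
    constructible P n pts (ObjLine l :: objs) ->
    constructible P (S n) pts objs
| constructible_circle n pts objs c q :
    In (center c) pts -> In q pts -> center c <> q ->
    on_circle c q ->
    constructible P n pts (ObjCircle c :: objs) ->
    constructible P (S n) pts objs
| constructible_intersection n pts objs o1 o2 p :
    In o1 objs -> In o2 objs -> distinct_objects o1 o2 ->
    on o1 p -> on o2 p ->
    constructible P n (p :: pts) objs ->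
    constructible P n pts objs
| constructible_free_plane n pts objs (U : point -> Prop) :
    open U -> (exists p, U p) ->
    (forall p, U p -> constructible P n (p :: pts) objs) ->
    constructible P n pts objs
(* The relatively open subset of [o] is its intersection with the open [V]. *)
| constructible_free_object n pts objs o (V : point -> Prop) :
    In o objs -> open V -> (exists p, on o p /\ V p) ->
    (forall p, on o p -> V p -> constructible P n (p :: pts) objs) ->
    constructible P n pts objs.

(* Main.v *)
Require Import Defs.
From Stdlib Require Import Reals List Lra.
From Coquelicot Require Import Coquelicot.
Import ListNotations.
Open Scope R_scope.

(** If the radii [a], [b] of [O_A], [O_B] differ, the inversion about the circle
    centered at the intersection [E] of [XY] and [AB] (the external center of similitude) and through
    [Z] swaps [O_A] and [O_B] and preserves [O_C], hence also preserves the inner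
    Soddy circle; so this circle meets [O_C] at the point [P] where the Soddy
    circle touches [O_C]. As [AB] is drawn, the line [XY], this circle and the
    line [CP] give a line through [C] and the Soddy center in three moves. If
    [a = b], the line [CZ] is the perpendicular bisector of [AB] and does the
    same in one move. Doing this for [C] and for [B], intersecting the two
    lines and drawing the circle takes [3 + 3 + 1] moves. *)

(** * Squared distances and affine combinations *)

Definition dist2 (p q : point) : R :=
  (fst p - fst q) ^ 2 + (snd p - snd q) ^ 2.

Definition affine (t : R) (p q : point) : point :=
  ((1 - t) * fst p + t * fst q, (1 - t) * snd p + t * snd q).

(** The metric half of external tangency; [tangent_of_touching] recovers the unique common point
    from it. *)
Definition touching (c1 c2 : circle) : Prop :=
  dist_pt (center c1) (center c2) = radius c1 + radius c2.

Definition contact (c1 c2 : circle) : point :=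
  affine (radius c1 / (radius c1 + radius c2)) (center c1) (center c2).

Lemma dist_pt_dist2 (p q : point) : dist_pt p q = sqrt (dist2 p q).
Proof. unfold dist_pt, dist_euc, dist2; now rewrite <- !Rsqr_pow2. Qed.

Lemma dist2_ge0 (p q : point) : 0 <= dist2 p q.
Proof. apply Rplus_le_le_0_compat; apply pow2_ge_0. Qed.

Lemma dist2_sym (p q : point) : dist2 p q = dist2 q p.
Proof. unfold dist2; ring. Qed.

Lemma dist2_refl (p : point) : dist2 p p = 0.
Proof. unfold dist2; ring. Qed.

Lemma dist2_eq0 (p q : point) : dist2 p q = 0 -> p = q.
Proof.
  destruct p as [p1 p2], q as [q1 q2]; unfold dist2.
  rewrite <- !Rsqr_pow2; simpl; intros H.
  destruct (Rplus_sqr_eq_0 _ _ H); f_equal; lra.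
Qed.

Lemma dist_pt_eq_iff (p q : point) (r : R) :
  0 <= r -> (dist_pt p q = r <-> dist2 p q = r ^ 2).
Proof.
  intros Hr; rewrite dist_pt_dist2; split; intros H.
  - rewrite <- H, <- Rsqr_pow2, Rsqr_sqrt by apply dist2_ge0; reflexivity.
  - rewrite H; apply sqrt_pow2, Hr.
Qed.

Lemma on_circle_iff (c : circle) (p : point) :
  on_circle c p <-> dist2 (center c) p = radius c ^ 2.
Proof. apply dist_pt_eq_iff, Rlt_le, radius_pos. Qed.

Lemma touching_iff (c1 c2 : circle) :
  touching c1 c2 <->
  dist2 (center c1) (center c2) = (radius c1 + radius c2) ^ 2.
Proof.
  apply dist_pt_eq_iff.
  pose proof (radius_pos c1); pose proof (radius_pos c2); lra.
Qed.

Lemma touching_sym (c1 c2 : circle) : touching c1 c2 -> touching c2 c1.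
Proof.
  rewrite !touching_iff, (dist2_sym (center c2)), (Rplus_comm (radius c2)); auto.
Qed.

Lemma touching_center_neq (c1 c2 : circle) :
  touching c1 c2 -> center c1 <> center c2.
Proof.
  rewrite touching_iff; intros H E; rewrite E in H.
  pose proof (radius_pos c1); pose proof (radius_pos c2).
  rewrite dist2_refl in H; nra.
Qed.

(* Stewart's theorem. *)
Lemma dist2_affine (t : R) (r p q : point) :
  dist2 r (affine t p q) =
  (1 - t) * dist2 r p + t * dist2 r q - t * (1 - t) * dist2 p q.
Proof. unfold dist2, affine; simpl; ring. Qed.

Lemma on_line_affine (l : line) (t : R) (p q : point) :
  on_line l p -> on_line l q -> on_line l (affine t p q).
Proof.
  unfold on_line, affine; simpl; intros Hp Hq.
  transitivity ((1 - t) * line_c l + t * line_c l);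
    [rewrite <- Hp at 1; rewrite <- Hq|]; ring.
Qed.

(** * Contact points of touching circles *)

Lemma contact_unique (c1 c2 : circle) (p : point) :
  touching c1 c2 -> on_circle c1 p -> on_circle c2 p -> p = contact c1 c2.
Proof.
  rewrite touching_iff, !on_circle_iff; intros H H1 H2.
  pose proof (radius_pos c1); pose proof (radius_pos c2).
  (* Stewart's theorem turns the two radius equations into squared distance zero. *)
  apply dist2_eq0; unfold contact.
  rewrite dist2_affine, (dist2_sym p), (dist2_sym p), H, H1, H2; field; lra.
Qed.

Lemma on_circle_contact (c1 c2 : circle) :
  touching c1 c2 ->
  on_circle c1 (contact c1 c2) /\ on_circle c2 (contact c1 c2).
Proof.
  rewrite touching_iff, !on_circle_iff; intros H.
  pose proof (radius_pos c1); pose proof (radius_pos c2).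
  unfold contact; rewrite !dist2_affine, !dist2_refl.
  rewrite (dist2_sym (center c2)), H; split; field; lra.
Qed.

Lemma tangent_of_touching (c1 c2 : circle) : touching c1 c2 -> tangent c1 c2.
Proof.
  intros H; exists (contact c1 c2); split.
  - now apply on_circle_contact.
  - intros q [H1 H2]; symmetry; now apply contact_unique.
Qed.

(** Stewart's theorem in the triangle of the three centers, whose side lengths are sums of radii. *)
Lemma dist2_contact (c c1 c2 : circle) :
  touching c c1 -> touching c c2 -> touching c1 c2 ->
  dist2 (center c) (contact c1 c2) =
  radius c ^ 2 + 4 * radius c * radius c1 * radius c2 / (radius c1 + radius c2).
Proof.
  rewrite !touching_iff; intros H1 H2 H12.
  pose proof (radius_pos c1); pose proof (radius_pos c2).
  unfold contact; rewrite dist2_affine, H1, H2, H12; field; lra.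
Qed.

Lemma contact_outside (c c1 c2 : circle) :
  touching c c1 -> touching c c2 -> touching c1 c2 ->
  radius c ^ 2 < dist2 (center c) (contact c1 c2).
Proof.
  intros; rewrite dist2_contact by assumption.
  pose proof (radius_pos c); pose proof (radius_pos c1); pose proof (radius_pos c2).
  enough (0 < 4 * radius c * radius c1 * radius c2 / (radius c1 + radius c2)) by lra.
  apply Rdiv_lt_0_compat; [|lra].
  repeat apply Rmult_lt_0_compat; lra.
Qed.

Lemma center_neq_contact (c1 c2 : circle) :
  touching c1 c2 -> center c1 <> contact c1 c2.
Proof.
  intros H E; destruct (on_circle_contact c1 c2 H) as [H1 _].
  rewrite <- E, on_circle_iff, dist2_refl in H1.
  pose proof (pow_lt _ 2 (radius_pos c1)); lra.
Qed.

(** With [on_line_affine], a line through one center and the contact point also contains the other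
    center. *)
Lemma center_ext_contact (c1 c2 : circle) :
  center c2 =
  affine ((radius c1 + radius c2) / radius c1) (center c1) (contact c1 c2).
Proof.
  pose proof (radius_pos c1); pose proof (radius_pos c2).
  unfold contact, affine; destruct (center c2) as [x y]; simpl.
  f_equal; field; lra.
Qed.

(** Collinearity makes the cross product [K] of two side vectors vanish, whereas the side lengths
    force its square, four times the squared area, to be positive. *)
Lemma not_collinear_centers (c1 c2 c3 : circle) (l : line) :
  touching c1 c2 -> touching c1 c3 -> touching c2 c3 ->
  on_line l (center c1) -> on_line l (center c2) -> ~ on_line l (center c3).
Proof.
  rewrite !touching_iff.
  pose proof (radius_pos c1); pose proof (radius_pos c2); pose proof (radius_pos c3).
  destruct (center c1) as [x1 y1], (center c2) as [x2 y2], (center c3) as [x3 y3].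
  set (a := radius c1) in *; set (b := radius c2) in *; set (c := radius c3) in *.
  unfold dist2, on_line; simpl fst; simpl snd; intros H12 H13 H23 L1 L2 L3.
  set (u := x2 - x1); set (v := y2 - y1); set (w := x3 - x1); set (z := y3 - y1).
  assert (K : u * z - v * w = 0).
  { assert (U : line_a l * u + line_b l * v = 0) by (unfold u, v; lra).
    assert (W : line_a l * w + line_b l * z = 0) by (unfold w, z; lra).
    destruct (line_nondeg l) as [N | N]; apply (Rmult_eq_reg_l _ _ _ ) with (2 := N).
    - transitivity (z * (line_a l * u + line_b l * v) - v * (line_a l * w + line_b l * z));
        [ring | rewrite U, W; ring].
    - transitivity (u * (line_a l * w + line_b l * z) - w * (line_a l * u + line_b l * v));
        [ring | rewrite U, W; ring]. }
  assert (E1 : u ^ 2 + v ^ 2 = (a + b) ^ 2) by (rewrite <- H12; unfold u, v; ring).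
  assert (E2 : w ^ 2 + z ^ 2 = (a + c) ^ 2) by (rewrite <- H13; unfold w, z; ring).
  assert (E3 : u * w + v * z = ((a + b) ^ 2 + (a + c) ^ 2 - (b + c) ^ 2) / 2).
  { rewrite <- H12, <- H13, <- H23; unfold u, v, w, z; field. }
  (* Heron's formula *)
  assert (F : (u * z - v * w) ^ 2 = 4 * (a * b * c * (a + b + c))).
  { transitivity ((u ^ 2 + v ^ 2) * (w ^ 2 + z ^ 2) - (u * w + v * z) ^ 2); [ring|].
    rewrite E1, E2, E3; field. }
  assert (0 < a * b * c * (a + b + c)) by (repeat apply Rmult_lt_0_compat; lra).
  rewrite K in F; lra.
Qed.

(** * Existence of lines and circles *)

Lemma line_through (p q : point) :
  p <> q -> exists l : line, on_line l p /\ on_line l q.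
Proof.
  intros N.
  assert (D : snd q - snd p <> 0 \/ fst p - fst q <> 0).
  { destruct (Req_dec (snd q - snd p) 0); [right | now left].
    intros E; apply N; destruct p, q; simpl in *; f_equal; lra. }
  exists (Line _ _ ((snd q - snd p) * fst p + (fst p - fst q) * snd p) D).
  unfold on_line; simpl; split; ring.
Qed.

Lemma perpendicular_bisector (p q : point) :
  p <> q -> exists l : line, forall r, dist2 r p = dist2 r q -> on_line l r.
Proof.
  intros N.
  assert (D : fst q - fst p <> 0 \/ snd q - snd p <> 0).
  { destruct (Req_dec (fst q - fst p) 0); [right | now left].
    intros E; apply N; destruct p, q; simpl in *; f_equal; lra. }
  exists (Line _ _ ((fst q ^ 2 + snd q ^ 2 - fst p ^ 2 - snd p ^ 2) / 2) D).
  unfold on_line, dist2; simpl; intros r H; nra.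
Qed.

Lemma circle_through (p q : point) :
  p <> q -> exists c : circle, center c = p /\ on_circle c q.
Proof.
  intros N.
  assert (H : 0 < dist_pt p q).
  { rewrite dist_pt_dist2; apply sqrt_lt_R0.
    destruct (dist2_ge0 p q) as [H | H]; [exact H|].
    now contradict N; apply dist2_eq0. }
  exists (Circle p _ H); split; reflexivity.
Qed.

Lemma on_same_circle (c : circle) (p q : point) :
  on_circle c p -> dist2 (center c) p = dist2 (center c) q -> on_circle c q.
Proof. rewrite !on_circle_iff; congruence. Qed.

(** * The inner Soddy circle *)

(** The distance equation from the Soddy center to the center of the circle of radius [a], with
    denominators cleared; it holds modulo Heron's relation for [D]. *)
Lemma soddy_identity (a b c D : R) :
  D ^ 2 = a * b * c * (a + b + c) ->
  (c * (b * (a + c) + D)) ^ 2 * (a + b) ^ 2 +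
  (b * (c * (a + b) + D)) ^ 2 * (a + c) ^ 2 +
  c * (b * (a + c) + D) * (b * (c * (a + b) + D)) *
    ((a + b) ^ 2 + (a + c) ^ 2 - (b + c) ^ 2) =
  (D * (a * b + b * c + c * a + 2 * D + b * c)) ^ 2.
Proof. intros H; ring [H]. Qed.

(** The barycentric coordinates of the inner Soddy center are
    [(b + c) + D / a : (c + a) + D / b : (a + b) + D / c], where [D] is the area
    of the triangle of centers; after multiplication by [a * b * c] they sum to
    [D * (a * b + b * c + c * a + 2 * D)]. *)
Definition soddy_weight (D a b c : R) : R :=
  b * c * (a * (b + c) + D) / (D * (a * b + b * c + c * a + 2 * D)).

(** Descartes' formula: the inverse is [1/a + 1/b + 1/c + 2 * sqrt (1/(a*b) + 1/(b*c) + 1/(c*a))]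
    when [D] is the area. *)
Definition soddy_radius (D a b c : R) : R :=
  a * b * c / (a * b + b * c + c * a + 2 * D).

Definition soddy_center (D a b c : R) (p q r : point) : point :=
  (soddy_weight D a b c * fst p + soddy_weight D b c a * fst q
     + soddy_weight D c a b * fst r,
   soddy_weight D a b c * snd p + soddy_weight D b c a * snd q
     + soddy_weight D c a b * snd r).

(** The vector from [p] is [v * (q - p) + w * (r - p)]; the law of cosines supplies the scalar
    product. *)
Lemma dist2_barycentric (u v w : R) (p q r : point) :
  u + v + w = 1 ->
  dist2 (u * fst p + v * fst q + w * fst r, u * snd p + v * snd q + w * snd r) p =
  v ^ 2 * dist2 p q + w ^ 2 * dist2 p r
  + v * w * (dist2 p q + dist2 p r - dist2 q r).
Proof.
  intros H; replace u with (1 - v - w) by lra; unfold dist2; simpl; ring.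
Qed.

Lemma dist2_soddy_center (D a b c : R) (p q r : point) :
  0 < a -> 0 < b -> 0 < c -> 0 < D -> D ^ 2 = a * b * c * (a + b + c) ->
  dist2 p q = (a + b) ^ 2 -> dist2 p r = (a + c) ^ 2 ->
  dist2 q r = (b + c) ^ 2 ->
  dist2 (soddy_center D a b c p q r) p = (soddy_radius D a b c + a) ^ 2.
Proof.
  intros Ha Hb Hc HD E Hpq Hpr Hqr.
  pose proof (Rmult_lt_0_compat _ _ Ha Hb).
  pose proof (Rmult_lt_0_compat _ _ Hb Hc).
  pose proof (Rmult_lt_0_compat _ _ Hc Ha).
  set (M := a * b + b * c + c * a + 2 * D).
  assert (HM : 0 < M) by (unfold M; lra).
  unfold soddy_center; rewrite dist2_barycentric.
  - rewrite Hpq, Hpr, Hqr.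
    transitivity ((a / (D * M)) ^ 2 *
      ((c * (b * (a + c) + D)) ^ 2 * (a + b) ^ 2 +
       (b * (c * (a + b) + D)) ^ 2 * (a + c) ^ 2 +
       c * (b * (a + c) + D) * (b * (c * (a + b) + D)) *
         ((a + b) ^ 2 + (a + c) ^ 2 - (b + c) ^ 2))).
    + unfold soddy_weight.
      replace (b * c + c * a + a * b + 2 * D) with M by (unfold M; ring).
      replace (c * a + a * b + b * c + 2 * D) with M by (unfold M; ring).
      field; lra.
    + rewrite (soddy_identity a b c D E); unfold soddy_radius; fold M.
      field; lra.
  - unfold soddy_weight.
    replace (b * c + c * a + a * b + 2 * D) with M by (unfold M; ring).
    replace (c * a + a * b + b * c + 2 * D) with M by (unfold M; ring).
    fold M.
    (* By Heron's relation the first term is [2 * D ^ 2], so the numerator equals [D * M]. *)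
    transitivity ((2 * (a * b * c * (a + b + c)) + D * (a * b + b * c + c * a))
      / (D * M)); [field; lra|].
    rewrite <- E; unfold M; field; fold M; lra.
Qed.

Lemma soddy_circle (c1 c2 c3 : circle) :
  touching c1 c2 -> touching c1 c3 -> touching c2 c3 ->
  exists s : circle, touching s c1 /\ touching s c2 /\ touching s c3.
Proof.
  rewrite !touching_iff.
  pose proof (radius_pos c1) as Ha; pose proof (radius_pos c2) as Hb.
  pose proof (radius_pos c3) as Hc.
  set (a := radius c1) in *; set (b := radius c2) in *; set (c := radius c3) in *.
  intros H12 H13 H23.
  assert (P : 0 < a * b * c * (a + b + c)) by (repeat apply Rmult_lt_0_compat; lra).
  set (D := sqrt (a * b * c * (a + b + c))).
  assert (HD : 0 < D) by now apply sqrt_lt_R0.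
  assert (E : D ^ 2 = a * b * c * (a + b + c)) by (apply pow2_sqrt; lra).
  assert (HR : 0 < soddy_radius D a b c).
  { pose proof (Rmult_lt_0_compat _ _ Ha Hb).
    pose proof (Rmult_lt_0_compat _ _ Hb Hc).
    pose proof (Rmult_lt_0_compat _ _ Hc Ha).
    apply Rdiv_lt_0_compat; [repeat apply Rmult_lt_0_compat|]; lra. }
  exists (Circle (soddy_center D a b c (center c1) (center c2) (center c3)) _ HR).
  rewrite !touching_iff; cbn [center radius]; fold a b c.
  split; [|split].
  - now apply dist2_soddy_center.
  (* Radius and center are invariant under cyclic relabeling, so the computation at one vertex
     serves all three. *)
  - replace (soddy_radius D a b c) with (soddy_radius D b c a)
      by (unfold soddy_radius; f_equal; ring).
    replace (soddy_center D a b c (center c1) (center c2) (center c3))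
      with (soddy_center D b c a (center c2) (center c3) (center c1))
      by (unfold soddy_center; f_equal; ring).
    apply dist2_soddy_center; auto;
      rewrite ?E, ?(dist2_sym _ (center c1)), ?H12, ?H13; ring.
  - replace (soddy_radius D a b c) with (soddy_radius D c a b)
      by (unfold soddy_radius; f_equal; ring).
    replace (soddy_center D a b c (center c1) (center c2) (center c3))
      with (soddy_center D c a b (center c3) (center c1) (center c2))
      by (unfold soddy_center; f_equal; ring).
    apply dist2_soddy_center; auto;
      rewrite ?E, ?(dist2_sym (center c3)), ?H12, ?H13, ?H23; ring.
Qed.

(** * The external center of similitude and its circle of inversion *)

Definition similitude_center (c1 c2 : circle) : point :=
  affine (radius c1 / (radius c1 - radius c2)) (center c1) (center c2).

(** Menelaus' theorem for the triangle of centers: this is what makes [E] the intersection of [XY]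
    with [AB]. *)
Lemma similitude_center_menelaus (c c1 c2 : circle) :
  radius c1 <> radius c2 ->
  similitude_center c1 c2 =
  affine (- radius c2 * (radius c1 + radius c)
            / (radius c * (radius c1 - radius c2)))
    (contact c2 c) (contact c1 c).
Proof.
  intros N.
  pose proof (radius_pos c); pose proof (radius_pos c1); pose proof (radius_pos c2).
  unfold similitude_center, contact, affine; simpl; f_equal; field; lra.
Qed.

(** By Stewart's theorem, the relation assumed of [p] is the equation of the circle of inversion
    about the center of similitude. *)
Lemma dist2_similitude_center (c1 c2 : circle) (p : point) :
  touching c1 c2 -> radius c1 <> radius c2 ->
  radius c1 * dist2 p (center c2) - radius c2 * dist2 p (center c1)
    = - radius c1 * radius c2 * (radius c1 - radius c2) ->
  dist2 (similitude_center c1 c2) p =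
  4 * (radius c1 * radius c2 / (radius c1 - radius c2)) ^ 2.
Proof.
  rewrite touching_iff; intros H N E.
  unfold similitude_center; rewrite dist2_sym, dist2_affine, H.
  transitivity
    ((radius c1 * dist2 p (center c2) - radius c2 * dist2 p (center c1))
       / (radius c1 - radius c2)
     + radius c1 * radius c2 * (radius c1 + radius c2) ^ 2
       / (radius c1 - radius c2) ^ 2); [field; lra|].
  rewrite E; field; lra.
Qed.

Lemma contact_power (c1 c2 : circle) :
  touching c1 c2 ->
  radius c1 * dist2 (contact c1 c2) (center c2)
    - radius c2 * dist2 (contact c1 c2) (center c1)
  = - radius c1 * radius c2 * (radius c1 - radius c2).
Proof.
  intros H; destruct (on_circle_contact c1 c2 H) as [P1 P2].
  apply on_circle_iff in P1, P2.
  rewrite !(dist2_sym (contact c1 c2)), P1, P2; ring.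
Qed.

Lemma similitude_center_neq_contact (c1 c2 : circle) :
  touching c1 c2 -> radius c1 <> radius c2 ->
  similitude_center c1 c2 <> contact c1 c2.
Proof.
  intros H N E.
  pose proof (dist2_similitude_center c1 c2 _ H N (contact_power c1 c2 H)) as D.
  rewrite <- E, dist2_refl in D.
  apply (pow_nonzero (radius c1 * radius c2 / (radius c1 - radius c2)) 2); [|lra].
  pose proof (radius_pos c1); pose proof (radius_pos c2).
  unfold Rdiv; repeat apply Rmult_integral_contrapositive_currified;
    [lra | lra | apply Rinv_neq_0_compat; lra].
Qed.

(** Both points satisfy the equation of the circle of inversion. For [contact c s], the extra terms
    from [dist2_contact] are proportional to [radius c1] and [radius c2] and cancel. *)
Lemma dist2_similitude_center_contact (c1 c2 c s : circle) :
  radius c1 <> radius c2 -> touching c1 c2 ->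
  touching c1 c -> touching c2 c -> touching s c1 -> touching s c2 ->
  touching s c ->
  dist2 (similitude_center c1 c2) (contact c s) =
  dist2 (similitude_center c1 c2) (contact c1 c2).
Proof.
  intros N H12 H1 H2 S1 S2 Sc.
  pose proof (radius_pos c); pose proof (radius_pos s).
  rewrite !dist2_similitude_center; auto.
  - now apply contact_power.
  - rewrite !(dist2_sym (contact c s)), !dist2_contact
      by auto using touching_sym.
    field; lra.
Qed.

(** * The construction *)

Lemma constructible_S (P : circle -> Prop) n pts objs :
  constructible P n pts objs -> constructible P (S n) pts objs.
Proof.
  induction 1 as
    [ n pts objs c | n pts objs l p q | n pts objs c q | n pts objs o1 o2 p
    | n pts objs U | n pts objs o V ].
  - now apply (constructible_drawn _ _ _ _ c).
  - now apply (constructible_line _ _ _ _ l p q).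
  - now apply (constructible_circle _ _ _ _ c q).
  - now apply (constructible_intersection _ _ _ _ o1 o2 p).
  - now apply (constructible_free_plane _ _ _ _ U).
  - now apply (constructible_free_object _ _ _ _ o V).
Qed.

(** Spends three moves on a line through the centers of [c] and [s]. The continuation accepts any
    larger configuration, so that two uses can be chained. *)
Lemma constructible_ray (P : circle -> Prop) n pts objs (c1 c2 c s : circle)
    (l : line) (X Y Z : point) :
  touching c1 c2 -> touching c1 c -> touching c2 c ->
  touching s c1 -> touching s c2 -> touching s c ->
  X = contact c2 c -> Y = contact c1 c -> Z = contact c1 c2 ->
  on_line l (center c1) -> on_line l (center c2) ->
  incl [ObjLine l; ObjCircle c] objs -> incl [center c; X; Y; Z] pts ->
  (forall m pts' objs',
     incl pts pts' -> incl objs objs' ->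
     on_line m (center c) -> on_line m (center s) -> In (ObjLine m) objs' ->
     constructible P n pts' objs') ->
  constructible P (S (S (S n))) pts objs.
Proof.
  intros H12 H1 H2 S1 S2 Sc EX EY EZ L1 L2 Iobjs Ipts K.
  assert (Zout : radius c ^ 2 < dist2 (center c) (contact c1 c2))
    by (apply contact_outside; auto using touching_sym).
  assert (NcZ : center c <> Z).
  { intros E; rewrite <- EZ, <- E, dist2_refl in Zout.
    pose proof (pow2_ge_0 (radius c)); lra. }
  assert (Nl : ~ on_line l (center c)) by now apply (not_collinear_centers c1 c2).
  destruct (Req_dec (radius c1) (radius c2)) as [R12 | N].
  { destruct (perpendicular_bisector (center c1) (center c2)) as [m Hm];
      [now apply touching_center_neq|].
    pose proof (on_circle_contact c1 c2 H12) as [P1 P2].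
    rewrite on_circle_iff in P1, P2.
    rewrite touching_iff in H1, H2, S1, S2.
    assert (on_line m (center c)) by
      (apply Hm; rewrite !(dist2_sym (center c)), H1, H2, R12; reflexivity).
    assert (on_line m (center s)) by
      (apply Hm; rewrite S1, S2, R12; reflexivity).
    assert (on_line m Z) by
      (apply Hm; rewrite !(dist2_sym Z), EZ, P1, P2, R12; reflexivity).
    (* The bisector costs one move; the other two are given up. *)
    do 2 apply constructible_S.
    apply (constructible_line _ _ _ _ m (center c) Z); auto 10 with datatypes.
    apply (K m); auto with datatypes. }
  set (E := similitude_center c1 c2).
  assert (NXl : ~ on_line l X).
  { intros LX; apply Nl; rewrite (center_ext_contact c2 c), <- EX.
    now apply on_line_affine. }
  (* [Y] lies on [c1], while [X] is strictly outside it. *)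
  assert (NYX : Y <> X).
  { intros EYX.
    pose proof (contact_outside c1 c2 c H12 H1 H2) as Xout.
    rewrite <- EX, <- EYX, EY in Xout.
    pose proof (proj1 (on_circle_iff _ _) (proj1 (on_circle_contact c1 c H1))); lra. }
  destruct (line_through Y X NYX) as [m [mY mX]].
  apply (constructible_line _ _ _ _ m Y X); auto 10 with datatypes.
  apply (constructible_intersection _ _ _ _ (ObjLine m) (ObjLine l) E);
    auto with datatypes.
  { intros D; now apply NXl, (D X). }
  { unfold on, E; rewrite (similitude_center_menelaus c), <- EX, <- EY by assumption.
    now apply on_line_affine. }
  { now apply on_line_affine. }
  destruct (circle_through E Z) as [g [gE gZ]].
  { rewrite EZ; now apply similitude_center_neq_contact. }
  apply (constructible_circle _ _ _ _ g Z); auto 10 with datatypes.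
  { rewrite gE; auto with datatypes. }
  { rewrite gE, EZ; now apply similitude_center_neq_contact. }
  apply (constructible_intersection _ _ _ _ (ObjCircle g) (ObjCircle c) (contact c s));
    auto with datatypes.
  (* [g] differs from [c] because it passes through [Z], which is outside [c]. *)
  { intros D; apply (D Z), on_circle_iff in gZ; rewrite EZ in gZ; lra. }
  { apply (on_same_circle g Z); [assumption|].
    rewrite gE, EZ; symmetry; now apply dist2_similitude_center_contact. }
  { now apply on_circle_contact, touching_sym. }
  assert (NcP : center c <> contact c s).
  { now apply center_neq_contact, touching_sym. }
  destruct (line_through _ _ NcP) as [k [kc kP]].
  apply (constructible_line _ _ _ _ k (center c) (contact c s));
    auto 10 with datatypes.
  apply (K k); auto 10 with datatypes.
  rewrite (center_ext_contact c s); now apply on_line_affine.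
Qed.

Theorem theorem4p1 (O_A O_B O_C : circle) (A B C X Y Z : point)
    (AB AC : line)
    (hA : center O_A = A) (hB : center O_B = B) (hC : center O_C = C)
    (hX : externally_tangent_at O_B O_C X)
    (hY : externally_tangent_at O_A O_C Y)
    (hZ : externally_tangent_at O_A O_B Z)
    (hAB : on_line AB A /\ on_line AB B)
    (hAC : on_line AC A /\ on_line AC C) :
  constructible
    (fun c => tangent c O_A /\ tangent c O_B /\ tangent c O_C)
    7
    [A; B; C; X; Y; Z]
    [ObjCircle O_A; ObjCircle O_B; ObjCircle O_C; ObjLine AB; ObjLine AC].
Proof.
  destruct hX as [[[XB XC] _] tBC], hY as [[[YA YC] _] tAC],
    hZ as [[[ZA ZB] _] tAB], hAB as [ABA ABB], hAC as [ACA ACC].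
  fold (touching O_B O_C) in tBC; fold (touching O_A O_C) in tAC;
    fold (touching O_A O_B) in tAB.
  subst A B C.
  destruct (soddy_circle O_A O_B O_C tAB tAC tBC) as [s [sA [sB sC]]].
  apply (constructible_ray _ 4 _ _ O_A O_B O_C s AB X Y Z);
    auto using contact_unique; try (intros ?; simpl; tauto).
  intros mC pts1 objs1 Ip1 Io1 mCC mCs ImC.
  (* The same with [B] and [C] exchanged, hence also [Y] and [Z]; one move remains for the
     circle. *)
  apply (constructible_ray _ 1 _ _ O_A O_C O_B s AC X Z Y);
    auto using contact_unique, touching_sym.
  { intros o Ho; apply Io1; simpl in *; tauto. }
  { intros p Hp; apply Ip1; simpl in *; tauto. }
  intros mB pts2 objs2 Ip2 Io2 mBB mBs ImB.
  apply (constructible_intersection _ _ _ _ (ObjLine mB) (ObjLine mC) (center s));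
    auto.
  (* If the lines coincided, the centers of the mutually touching [s], [O_B], [O_C] would be
     collinear. *)
  { intros D; apply (not_collinear_centers s O_B O_C mC); auto.
    now apply (D (center O_B)). }
  (* Drawing [s] also requires a known point on it: its contact with [O_C], which lies on [mC]. *)
  destruct (on_circle_contact s O_C sC) as [Ps PC].
  apply (constructible_intersection _ _ _ _ (ObjLine mC) (ObjCircle O_C) (contact s O_C));
    auto.
  { apply Io2, Io1; simpl; tauto. }
  { intros D; apply (D (center O_C)), on_circle_iff in mCC.
    rewrite dist2_refl in mCC; pose proof (pow_lt _ 2 (radius_pos O_C)); lra. }
  { now apply on_line_affine. }
  apply (constructible_circle _ _ _ _ s (contact s O_C)); auto with datatypes.
  { now apply center_neq_contact. }
  apply (constructible_drawn _ _ _ _ s); auto using tangent_of_touching with datatypes.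
Qed.
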